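(* Let $(X,d)$ be a complete, connected, locally compact, non-compact geodesic space. For any non-empty compact subset $K_0\subset X$ and any dl-function $u:X\to\mathbb{R}$ such that $u|_{K_0}\ge 0$, we have $$u_{K_0}\le u\quad\text{on } X.$$
   Context: A geodesic space is a length space in which the distance between any two points is attained by the length of some Lipschitz curve connecting them. For a non-empty closed set $H\subseteq X$, $d(x,H)=\inf_{h\in H}d(x,h)$. A function $u:X\to\mathbb{R}$ is a dl-function (distance-like function) if there are a sequence of (non-empty) closed subsets $H_n\subseteq X$ diverging to infinity (i.e. $d(x_0,H_n)\to\infty$ for some $x_0\in X$) and real numbers $c_n$ such that $u(x)=\lim_{n\to\infty}[d(x,H_n)-c_n]$, the limit being in the compact-open topology (uniform on compact sets). For a non-empty compact $K_0\subset X$, let $S_r(K_0)=\{x\in X: d(x,K_0)=r\}$ for $r>0$; the $K_0$-assigned dl-function is $u_{K_0}(x)=\lim_{r\to+\infty}[d(x,S_r(K_0))-r]$ (this limit exists for every $x\in X$). *)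

(* Defs.v *)
From HB Require Import structures.
From mathcomp Require Import all_boot all_order all_algebra.
From mathcomp Require Import all_classical all_reals all_analysis.

Set Implicit Arguments.
Unset Strict Implicit.
Unset Printing Implicit Defensive.

Import Order.TTheory GRing.Theory Num.Theory.
Import numFieldNormedType.Exports.

Local Open Scope classical_set_scope.
Local Open Scope ring_scope.

Section GeodesicSpaces.
Context {R : realType} {X : metricType R}.

(* The library's [completeType] requires a pointed carrier; this is the field
   of its mixin, with [cvg F] (stated with [lim], hence with a point) replaced
   by the existence of a limit. *)
Definition complete_space : Prop :=
  forall F : set_system X, ProperFilter F -> cauchy F -> exists x : X, F --> x.

(* Metric-space version of [variation] and [total_variation]: a partition of
   [a, b] is given by the list s of its nodes other than a. *)
Definition polygonal_length (a b : R) (g : R -> X) (s : seq R) : R :=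
  let G := g \o nth b (a :: s) in
  \sum_(0 <= n < size s) mdist (G n) (G n.+1).

Definition curve_length (a b : R) (g : R -> X) : \bar R :=
  ereal_sup [set (polygonal_length a b g s)%:E | s in itv_partition a b].

(* The library's [lipschitz] is only available between normed modules. *)
Definition lipschitz_curve (a b : R) (g : R -> X) : Prop :=
  exists k : R, forall s t : R, s \in `[a, b] -> t \in `[a, b] ->
    mdist (g s) (g t) <= k * `|s - t|.

(* Curves are parametrized by arbitrary compact intervals; the values of g
   outside [a, b] play no role. *)
Definition lipschitz_curve_lengths (x y : X) : set (\bar R) :=
  [set l | exists (a b : R) (g : R -> X),
    [/\ a <= b, lipschitz_curve a b g, g a = x, g b = y
      & l = curve_length a b g]].

Definition length_space : Prop :=
  forall x y : X, (mdist x y)%:E = ereal_inf (lipschitz_curve_lengths x y).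

Definition geodesic_space : Prop :=
  length_space /\
  forall x y : X, lipschitz_curve_lengths x y (mdist x y)%:E.

(* For A = set0 this is the default value inf set0 = 0. *)
Definition dist_set (x : X) (A : set X) : R := inf [set mdist x a | a in A].

Definition dl_function (u : X -> R) : Prop :=
  exists (H : nat -> set X) (c : nat -> R),
    [/\ forall n, closed (H n),
        forall n, H n !=set0,
        exists x0 : X, dist_set x0 (H n) @[n --> \oo] --> +oo
      & {compact-open, (fun n (x : X) => dist_set x (H n) - c n) @ \oo --> u}].

Definition sphere_set (K0 : set X) (r : R) : set X :=
  [set x | dist_set x K0 = r].

Definition assigned_dl (K0 : set X) (x : X) : R :=
  lim (dist_set x (sphere_set K0 r) - r @[r --> +oo]).

End GeodesicSpaces.

Arguments complete_space {R} X.
Arguments length_space {R} X.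
Arguments geodesic_space {R} X.

(* Main.v *)
(* Both sides are compared before taking limits.  Let h in H_n nearly realize
   d(x, H_n), with n so large that d(h, K0) >= r.  A geodesic from x to h meets
   the sphere S_r(K0) at some z, and z lies within r of some k in K0, so that
   d(x, S_r) <= d(x, z) = d(x, h) - d(z, h) and d(z, h) >= d(k, H_n) - r.  As
   d(k, H_n) - c_n > - e uniformly on K0 for large n, this gives
   d(x, S_r) - r <= u x.  The same crossing argument makes d(x, S_r) - r
   nondecreasing in r >= d(x, K0), so its limit exists and is at most u x. *)
Require Import Defs.
From HB Require Import structures.
From mathcomp Require Import all_boot all_order all_algebra.
From mathcomp Require Import all_classical all_reals all_analysis.
From mathcomp Require Import lra.

Import Order.TTheory GRing.Theory Num.Theory.
Import numFieldNormedType.Exports.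

Local Open Scope classical_set_scope.
Local Open Scope ring_scope.

Section DistanceToSet.
Context {R : realType} {X : metricType R}.
Implicit Types (x y : X) (A : set X).

Lemma dist_set_le x A a : A a -> dist_set x A <= mdist x a.
Proof.
move=> Aa; apply: ge_inf; last by exists a.
by exists 0 => _ [b _ <-]; exact: mdist_ge0.
Qed.

Lemma le_dist_set x A (c : R) :
  A !=set0 -> (forall a, A a -> c <= mdist x a) -> c <= dist_set x A.
Proof.
move=> [a Aa] cA; apply: lb_le_inf; first by exists (mdist x a), a.
by move=> _ [b Ab <-]; exact: cA.
Qed.

Lemma dist_set_adherent x A (e : R) :
  A !=set0 -> 0 < e -> exists2 a, A a & mdist x a < dist_set x A + e.
Proof.
move=> [a Aa] e0.
have hi : has_inf [set mdist x b | b in A].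
  split; first by exists (mdist x a), a.
  by exists 0 => _ [b _ <-]; exact: mdist_ge0.
by have [_ [b Ab <-] ?] := inf_adherent e0 hi; exists b.
Qed.

Lemma dist_set_triangle x y A :
  A !=set0 -> dist_set x A <= mdist x y + dist_set y A.
Proof.
move=> A0; rewrite -lerBlDl; apply: le_dist_set => // a Aa.
by rewrite lerBlDl (le_trans (dist_set_le x A a Aa))// metric_triangle.
Qed.

(** Makes divergence from one base point uniform over a compact set. The empty set is treated apart,
    as the extreme value theorem needs a point. *)
Lemma compact_mdist_bounded x A :
  compact A -> exists M : R, forall a, A a -> mdist x a <= M.
Proof.
have [[a Aa] cA|A0] := pselect (A !=set0); last first.
  by exists 0 => a Aa; case: A0; exists a.
have ctx : continuous (mdist x).
  move=> y; apply/cvgrPdist_lt => e e0; near=> z.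
  have : ball y e z by near: z; exact: nbhsx_ballx.
  rewrite ballEmdist /= => yz.
  have := metric_triangle x y z; have := metric_triangle x z y.
  by rewrite (metric_sym z y) ltr_norml => *; apply/andP; split; lra.
have [||c _ cmax] := @compact_EVT_max _ _ (mdist x) A _ cA.
- by exists a.
- exact: continuous_subspaceT.
by exists (mdist x c) => b Ab; apply: cmax; rewrite inE.
Unshelve. all: by end_near. Qed.

End DistanceToSet.

Section Geodesics.
Context {R : realType} {X : metricType R}.
Implicit Types (x y : X) (K : set X).

(** The partition with nodes [a], [t], [b]; both inequalities are strict because partition nodes
    increase strictly. *)
Lemma curve_length_ge (a b t : R) (g : R -> X) : a < t -> t < b ->
  ((mdist (g a) (g t) + mdist (g t) (g b))%:E <= curve_length a b g)%E.
Proof.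
move=> at_ tb; apply: ereal_sup_ubound => /=.
exists [:: t; b]; first by rewrite /itv_partition /= at_ tb eqxx.
by rewrite /polygonal_length /= big_nat_recr //= big_nat1.
Qed.

Lemma lipschitz_within_continuous (a b k : R) (f : R -> R) :
  (forall s t, s \in `[a, b] -> t \in `[a, b] -> `|f s - f t| <= k * `|s - t|) ->
  {within `[a, b], continuous f}.
Proof.
move=> fk; apply/subspace_continuousP => s sab.
apply/cvgrPdist_lt => e e0; near=> t.
have tab : t \in `[a, b] by near: t; exact: withinT.
(* [k] may be zero or negative, hence the positive substitute. *)
have k0 : 0 < `|k| + 1 by rewrite ltr_wpDl.
have st : `|s - t| < e / (`|k| + 1).
  near: t; apply: cvg_within; apply: nbhsx_ballx; exact: divr_gt0.
rewrite ltr_pdivlMr// mulrC in st.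
apply: le_lt_trans (fk _ _ sab tab) (le_lt_trans _ st).
by rewrite ler_wpM2r// (le_trans (ler_norm _))// lerDl.
Unshelve. all: by end_near. Qed.

(** The distance to [K] is 1-Lipschitz, hence continuous along a geodesic, and takes the value [r]
    by the intermediate value theorem. Splitting the geodesic there forces equality in the triangle
    inequality. *)
Lemma geodesic_crossing x y K (r : R) : geodesic_space X -> K !=set0 ->
  dist_set x K <= r -> r <= dist_set y K ->
  exists2 z, sphere_set K r z & mdist x y = mdist x z + mdist z y.
Proof.
move=> [_ /(_ x y)] [a [b [g [ab [k gk] <- <- gl]]]] K0 xr ry.
have [t tab ft] : exists2 t, t \in `[a, b] & dist_set (g t) K = r.
  apply: IVT => //; last first.
    by rewrite (min_idPl _) ?(max_idPr _) ?xr// (le_trans xr).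
  apply: (lipschitz_within_continuous _ _ k) => s t sab tab.
  apply: le_trans (gk _ _ sab tab).
  have := dist_set_triangle (g s) (g t) K K0.
  have := dist_set_triangle (g t) (g s) K K0.
  by rewrite (metric_sym _ (g t)) ler_norml => *; apply/andP; split; lra.
exists (g t) => //.
move: tab; rewrite in_itv /= => /andP[].
(* At an endpoint one of the two distances vanishes; only an interior [t] gives a partition. *)
rewrite le_eqVlt => /predU1P[<- _|at_]; first by rewrite mdistxx add0r.
rewrite le_eqVlt => /predU1P[->|tb]; first by rewrite mdistxx addr0.
apply/eqP; rewrite eq_le metric_triangle/=.
by rewrite -lee_fin gl curve_length_ge.
Qed.

End Geodesics.

Section AssignedDl.
Context {R : realType} {X : metricType R}.
Hypothesis X_geodesic : geodesic_space X.
Variable K : set X.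
Hypotheses (K_nonempty : K !=set0) (K_compact : compact K).

Definition sphere_dl (x : X) (r : R) : R := dist_set x (sphere_set K r) - r.

(** A geodesic from [x] to the outer sphere spends at least [s - r] beyond the inner one. An empty
    outer sphere would give [dist_set] its default value 0. *)
Lemma sphere_dl_le (x : X) (r s : R) : dist_set x K <= r -> r <= s ->
  sphere_set K s !=set0 -> sphere_dl x r <= sphere_dl x s.
Proof.
move=> xr rs Ss; rewrite /sphere_dl.
suff : dist_set x (sphere_set K r) + (s - r) <= dist_set x (sphere_set K s).
  by move=> *; lra.
apply: le_dist_set => // y ys.
have ry : r <= dist_set y K by rewrite (ys : dist_set y K = s).
have [z zr ->] := geodesic_crossing x y K r X_geodesic K_nonempty xr ry.
have := dist_set_triangle y z K K_nonempty.
rewrite (metric_sym y z) [dist_set y K]ys [dist_set z K]zr.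
by have := dist_set_le x _ z zr; move=> *; lra.
Qed.

Lemma dl_function_far (H : nat -> set X) (x0 : X) (r : R) :
  dist_set x0 (H n) @[n --> \oo] --> +oo ->
  \forall n \near \oo, forall h, H n h -> r <= dist_set h K.
Proof.
have [M KM] := compact_mdist_bounded x0 K K_compact.
move=> /cvgryPge/(_ (r + M)); apply: filterS => n Hn h Hh.
apply: le_dist_set => // k Kk.
have := dist_set_le x0 (H n) h Hh; have := KM _ Kk.
have := metric_triangle x0 k h; rewrite (metric_sym k) => *; lra.
Qed.

(** The sets [H n] defining [u] contain points arbitrarily far from [K], and a geodesic from [x] to
    such a point crosses the sphere. *)
Lemma sphere_nonempty (u : X -> R) (x : X) (r : R) : dl_function u ->
  dist_set x K <= r -> sphere_set K r !=set0.
Proof.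
move=> [H [_ [_ H0 [x0 Hoo] _]]] xr.
have [n Fn] := @filter_ex _ _ _ _ (dl_function_far H x0 r Hoo).
have [h /Fn rh] := H0 n.
by have [z] := geodesic_crossing x h K r X_geodesic K_nonempty xr rh; exists z.
Qed.

Lemma sphere_dl_le_dl (u : X -> R) : dl_function u ->
  (forall k, K k -> 0 <= u k) ->
  forall x r, dist_set x K <= r -> sphere_dl x r <= u x.
Proof.
move=> [H [c [_ H0 [x0 Hoo] /compact_open_cvgP Hu]]] u0 x r xr.
apply/ler_addgt0Pr => e e0.
(* Four errors add up to [e]: the limit at [x], the limit on [K], and the choices of [h] and [k]. *)
have e4 : 0 < e / 4 by rewrite divr_gt0.
have ux : \forall n \near \oo, dist_set x (H n) - c n < u x + e / 4.
  have : [set u y | y in [set x]] `<=` [set v : R | v < u x + e / 4].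
    by move=> _ [_ -> <-] /=; rewrite ltrDl.
  move=> /(Hu _ _ (@compact_set1 X x) (@open_lt R _)); rewrite /fmap /= => uO.
  apply: (@filterS _ \oo _ _ _ _ uO) => n nx /=; by apply: nx; exists x.
(* Uniformity over [K] matters: the point [k] used below is chosen after [n]. *)
have uK : \forall n \near \oo,
    forall k, K k -> - (e / 4) < dist_set k (H n) - c n.
  have : [set u k | k in K] `<=` [set v : R | - (e / 4) < v].
    by move=> _ [k /u0 uk <-] /=; rewrite (lt_le_trans _ uk)// oppr_lt0.
  move=> /(Hu _ _ K_compact (@open_gt R _)); rewrite /fmap /= => uO.
  apply: (@filterS _ \oo _ _ _ _ uO) => n nK k Kk; by apply: nK; exists k.
have far := dl_function_far _ _ r Hoo.
have [n [xn Kn Fn]] : exists n, [/\ dist_set x (H n) - c n < u x + e / 4,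
    forall k, K k -> - (e / 4) < dist_set k (H n) - c n &
    forall h, H n h -> r <= dist_set h K].
  near \oo => n; exists n; split; near: n; assumption.
have [h Hh xh] := dist_set_adherent x _ _ (H0 n) e4.
have [z zr xzh] := geodesic_crossing x h K r X_geodesic K_nonempty xr (Fn _ Hh).
have [k Kk zk] := dist_set_adherent z _ _ K_nonempty e4.
have := dist_set_triangle k z _ (H0 n); have := Kn _ Kk.
have := dist_set_le z (H n) h Hh; have := dist_set_le x _ z zr.
rewrite /sphere_dl (metric_sym k z); rewrite [dist_set z K]zr in zk.
by move=> *; lra.
Unshelve. all: by end_near. Qed.

Lemma assigned_dl_le (u : X -> R) (x : X) : dl_function u ->
  (forall k, K k -> 0 <= u k) -> assigned_dl K x <= u x.
Proof.
move=> u_dl u0; set r0 := dist_set x K.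
(* Monotonicity starts only at [r0]; freezing the radius below it gives a function monotone on all
   of [R] with the same limit at infinity. *)
pose f r := sphere_dl x (Num.max r0 r).
have fu r : f r <= u x by apply: sphere_dl_le_dl; rewrite // le_max lexx.
have fh : {homo f : r s / r <= s}.
  move=> r s rs; apply: sphere_dl_le.
  - by rewrite le_max lexx.
  - by rewrite ge_max !le_max lexx rs orbT.
  - by apply: (sphere_nonempty u x) => //; rewrite le_max lexx.
have fcvg : sphere_dl x r @[r --> +oo] --> sup (range f).
  apply: cvg_trans (nondecreasing_cvgr fh _); last by exists (u x) => _ [r _ <-].
  apply: near_eq_cvg; exists r0; split; first exact: num_real.
  by move=> r /ltW r0r; rewrite /f max_r.
rewrite /assigned_dl (cvg_lim _ fcvg)//.
by apply: ge_sup => [|_ [r _ <-]//]; exists (f 0), 0.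
Qed.

End AssignedDl.

Theorem theorem1p8 (R : realType) (X : metricType R)
  (X_complete : complete_space X)
  (X_connected : connected [set: X])
  (X_locally_compact : locally_compact [set: X])
  (X_noncompact : ~ compact [set: X])
  (X_geodesic : geodesic_space X)
  (K0 : set X) (K0_nonempty : K0 !=set0) (K0_compact : compact K0)
  (u : X -> R) (u_dl : dl_function u)
  (u_ge0 : forall x : X, K0 x -> 0 <= u x) :
  forall x : X, assigned_dl K0 x <= u x.
Proof. by move=> x; apply: assigned_dl_le. Qed.
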